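(* Let $p$ be a prime number, $\mathbb{F}_{p^m}$ a finite field of characteristic $p$, $\gamma\in\mathbb{F}_{p^m}\setminus\{0\}$, and let $\eta,s$ be positive integers. Suppose that $x^\eta+\gamma\in\mathbb{F}_{p^m}[x]$ is irreducible. Then the $\lambda$-cyclic codes over $\mathbb{F}_{p^m}$ of length $\eta p^s$ are of the form $C[i]=\langle(x^\eta+\gamma)^i\rangle$, where $0\le i\le p^s$ and $\lambda=-\gamma^{p^s}$. If $i=0$, then $C[i]$ is the whole space $\mathbb{F}_{p^m}^{\eta p^s}$, and if $i=p^s$, then $C[i]$ is the zero space. For the remaining values of $i$: if $p=2$, then $$d_H(C[i])=\begin{cases}2,&\text{if }1\le i\le 2^{s-1},\\ 2^{k+1},&\text{if }2^s-2^{s-k}+1\le i\le 2^s-2^{s-k}+2^{s-k-1},\ \text{where }1\le k\le s-1\end{cases}$$ (and $d_H(C[0])=1$); if $p$ is odd, then $$d_H(C[i])=\begin{cases}2,&\text{if }1\le i\le p^{s-1},\\ \beta+2,&\text{if }\beta p^{s-1}+1\le i\le(\beta+1)p^{s-1},\ \text{where }1\le\beta\le p-2,\\ (\tau+1)p^k,&\text{if }p^s-p^{s-k}+(\tau-1)p^{s-k-1}+1\le i\le p^s-p^{s-k}+\tau p^{s-k-1},\\ &\text{where }1\le\tau\le p-1\text{ and }1\le k\le s-1.\end{cases}$$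
   Context: A linear code over $\mathbb{F}_{p^m}$ of length $N$ is $\lambda$-cyclic ($\lambda\ne0$) if it is closed under $(c_0,\dots,c_{N-1})\mapsto(\lambda c_{N-1},c_0,\dots,c_{N-2})$; identifying codewords with polynomials of degree less than $N$, the $\lambda$-cyclic codes are exactly the ideals of $\mathbb{F}_{p^m}[x]/\langle x^N-\lambda\rangle$. The Hamming weight $w_H$ is the number of nonzero coefficients, and $d_H(C)=\min\{w_H(c):0\ne c\in C\}$. *)

(* Defs.v *)
From mathcomp Require Import all_boot all_order all_algebra.
Set Implicit Arguments.
Unset Strict Implicit.
Unset Printing Implicit Defensive.
Import GRing.Theory.
Local Open Scope ring_scope.

Section Codes.
Variables (F : finFieldType) (N : nat).
Implicit Types (lambda : F) (c : 'rV[F]_N) (C : {set 'rV[F]_N}).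

(* [ord_pred] is cyclic: the predecessor of index 0 is N - 1. *)
Definition constashift lambda c : 'rV[F]_N :=
  \row_(j < N) (if j == 0%N :> nat then lambda * c 0 (ord_pred j)
                else c 0 (ord_pred j)).

Definition constacyclic lambda C : Prop :=
  [/\ lambda != 0, submod_closed C
    & forall c, c \in C -> constashift lambda c \in C].

(* The class modulo 'X^N - lambda of c_0 + c_1 X + ... + c_(N-1) X^(N-1).
   For 0 < N the modulus is monic of positive degree, so that
   {poly %/ 'X^N - lambda%:P} is the genuine quotient ring. *)
Definition codeword_poly lambda c : {poly %/ 'X^N - lambda%:P} :=
  in_qpoly ('X^N - lambda%:P) (rVpoly c).

(* The words whose polynomial lies in the principal ideal <g> of
   F[X] / <X^N - lambda>. *)
Definition ideal_code lambda (g : {poly F}) : {set 'rV[F]_N} :=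
  [set c | [exists q : {poly %/ 'X^N - lambda%:P},
              codeword_poly lambda c == q * in_qpoly ('X^N - lambda%:P) g]].

Definition hamming_weight c : nat := #|[set j | c 0 j != 0]|.

(* As weights are at most N, the default value N only matters for codes
   without a nonzero codeword. *)
Definition min_distance C : nat :=
  \big[minn/N]_(c in C | c != 0) hamming_weight c.

End Codes.

(* Main.v *)
Require Import Defs.
From mathcomp Require Import all_boot all_order all_algebra finfield zify ring.
Set Implicit Arguments.
Unset Strict Implicit.
Unset Printing Implicit Defensive.
Import GRing.Theory.
Local Open Scope ring_scope.

(** Write f = X^eta + gamma and N = eta * p^s. In characteristic p the modulus
X^N + gamma^(p^s) is f^(p^s), so a constacyclic code is an ideal of
F[X]/<f^(p^s)> with f irreducible. If the code is nonzero and i is the largest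
exponent such that f^i divides all codewords, some codeword is f^i * u with u
prime to f; u is a unit modulo f^(p^s), so f^i itself is in the code and the
code is <f^i>
([constacyclic_irreducible_exp]).

The minimum distance of <f^i> is the minimum, over i <= e < p^s, of
digit_prod p s e, the product of (digit + 1) over the base-p digits of e
([min_distance_binomial_code]).

- Upper bound: f^(p^j) is again a binomial, so splitting e along its digits
  writes f^e as a product of powers of binomials, where a digit d contributes a
  factor with at most d + 1 terms; the weight is submultiplicative
  ([poly_weight_exp_binomial]).

- Lower bound (Massey, Costello and Justesen, for eta = 1): if a nonzero a is a
  root of c of multiplicity exactly e, then c has at least digit_prod p s e
  terms ([poly_weight_root_mult]). Split c by residues of exponents modulo p,
  c = sum of X^r c_r(X^p). With e = p t + e0, all the c_r are divisible by
  (X - a^p)^t, and the values at a^p of the quotients are the coefficients of a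
  nonzero polynomial of degree less than p, divisible by (X - a)^e0. Such a
  polynomial has more than e0 terms, so more than e0 of the c_r have a^p as a
  root of multiplicity exactly t, and induction applies to each of them.

- The case of any eta reduces to eta = 1 by splitting c by residues of
  exponents modulo eta: the parts are multiples of (X + gamma)^i of degree less
  than p^s ([digit_prod_le_multiple]).

It remains to minimise digit_prod. On each interval of exponents in the
theorem the minimum is attained at e = p^s - p^(s-k) + tau p^(s-k-1), whose
digits, from the top, are k times p - 1, then tau, then zeros; the value there
is (tau + 1) p^k ([digit_prod_band], [digit_prod_band_end]). The case p = 2 and
the first two cases for odd p are the cases tau = 1 and k = 0 of this formula
([min_distance_band]). *)

(** * Products of base-p digits *)

Section DigitProducts.
Local Open Scope nat_scope.

(** By Lucas, the weight of (X + 1)^e in characteristic p when e < p^s. With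
the number s of digits as a parameter, a digit can be split off at either end of
the expansion: the bottom end serves the lower bound on weights, the top end the
upper bound and the minimisation. *)
Definition digit_prod (p s e : nat) : nat :=
  \prod_(j < s) ((e %/ p ^ j) %% p).+1.

Lemma digit_prod_recl p s e :
  digit_prod p s.+1 e = (e %% p).+1 * digit_prod p s (e %/ p).
Proof.
rewrite /digit_prod big_ord_recl expn0 divn1; congr (_ * _).
by apply: eq_bigr => j _; rewrite /= /bump add1n expnS divnMA.
Qed.

Lemma digit_prod_modn p s e : digit_prod p s (e %% p ^ s) = digit_prod p s e.
Proof.
apply: eq_bigr => -[j /= lt_js] _.
by rewrite !modn_divl -expnS modn_dvdm // dvdn_exp2l.
Qed.

Lemma digit_prod_recr p s e : e < p ^ s.+1 ->
  digit_prod p s.+1 e = (e %/ p ^ s).+1 * digit_prod p s (e %% p ^ s).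
Proof.
move=> lt_e; rewrite digit_prod_modn /digit_prod big_ord_recr /= mulnC.
rewrite [_ %% p]modn_small // ltn_divLR -?expnS //.
by move: lt_e; rewrite expnS; case: (p ^ s) => //; rewrite muln0.
Qed.

Lemma digit_prod_gt0 p s e : 0 < digit_prod p s e.
Proof. by apply: prodn_gt0. Qed.

Lemma digit_prod_gt1 p s e : 0 < e < p ^ s -> 1 < digit_prod p s e.
Proof.
elim: s e => [|s IHs] e /andP[e_gt0 lt_e]; first by rewrite expn0 in lt_e; lia.
have q_gt0 : 0 < p ^ s by rewrite expnS in lt_e; case: (p ^ s) lt_e; lia.
rewrite digit_prod_recr //.
have [q0|q_neq0] := posnP (e %/ p ^ s).
  rewrite q0 mul1n IHs // ltn_mod q_gt0 andbT.
  by rewrite (divn_eq e (p ^ s)) q0 in e_gt0.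
by have := digit_prod_gt0 p s (e %% p ^ s); nia.
Qed.

(** Peel off top digits. The lower bound on e forces the top k digits to be
p - 1, each giving a factor p. The next digit either is at least tau, or it is
tau - 1 and then nonzero digits remain below it, giving a factor at least 2;
and 2 * tau >= tau + 1. *)
Lemma digit_prod_band p l k tau e : 0 < tau < p -> e < p ^ (l + k).+1 ->
  p ^ (l + k).+1 + (tau - 1) * p ^ l < e + p ^ l.+1 ->
  (tau + 1) * p ^ k <= digit_prod p (l + k).+1 e.
Proof.
case/andP=> tau_gt0 lt_tau.
have p_gt0 : 0 < p by exact: leq_trans lt_tau.
elim: k e => [|k IHk] e lt_e lo_e.
  rewrite addn0 muln1 in lt_e lo_e *; rewrite digit_prod_recr //.
  have pl_gt0 : 0 < p ^ l by rewrite expn_gt0 p_gt0.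
  have := divn_eq e (p ^ l); have := ltn_pmod e pl_gt0.
  have := @digit_prod_gt1 p l (e %% p ^ l).
  have := digit_prod_gt0 p l (e %% p ^ l).
  set r := e %% _; set q := e %/ _.
  set P := digit_prod _ _ _ => P0 P1 lt_r def_e.
  have lo_qr : (tau - 1) * p ^ l < q * p ^ l + r by lia.
  have [le_q|lt_q] := leqP tau q; first by nia.
  have q_def : q = tau - 1 by nia.
  have r_gt0 : 0 < r by nia.
  by move: P1; rewrite r_gt0 lt_r => /(_ isT); nia.
(* The top digit is p - 1; strip it. *)
rewrite addnS in lt_e lo_e *; rewrite digit_prod_recr //.
set Q := p ^ (l + k).+1 in IHk *.
have Q_gt0 : 0 < Q by rewrite expn_gt0 p_gt0.
have EQ : p ^ (l + k).+2 = p * Q by rewrite -expnS.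
have le_lQ : p ^ l.+1 <= Q by rewrite leq_pexp2l //; lia.
have := divn_eq e Q; have := ltn_pmod e Q_gt0.
move: (IHk (e %% Q)); set r := e %% _; set q := e %/ _ => IH lt_r def_e.
have q_def : q = p - 1.
  have : q < p by rewrite ltn_divLR // -EQ.
  by rewrite EQ in lo_e; nia.
rewrite EQ q_def in lo_e def_e.
have {}IH : (tau + 1) * p ^ k <= digit_prod p (l + k).+1 r.
  by apply: IH => //; nia.
by rewrite q_def expnS mulnCA leq_mul // subn1 prednK.
Qed.

Lemma digit_prod_band_end p l k tau : tau < p ->
  digit_prod p (l + k).+1 (p ^ (l + k).+1 - p ^ l.+1 + tau * p ^ l)
  = (tau + 1) * p ^ k.
Proof.
move=> lt_tau; have p_gt0 : 0 < p by exact: leq_trans lt_tau.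
have pl_gt0 : 0 < p ^ l by rewrite expn_gt0 p_gt0.
elim: k => [|k IHk].
  rewrite addn0 subnn add0n digit_prod_recr; last by rewrite expnS ltn_pmul2r.
  rewrite mulnK // modnMl muln1 addn1 /digit_prod big1 ?muln1 // => j _.
  by rewrite div0n mod0n.
rewrite addnS.
set Q := p ^ (l + k).+1 in IHk *.
have Q_gt0 : 0 < Q by rewrite expn_gt0 p_gt0.
have EQ : p ^ (l + k).+2 = p * Q by rewrite -expnS.
have le_lQ : p ^ l.+1 <= Q by rewrite leq_pexp2l //; lia.
have lt_l : tau * p ^ l < p ^ l.+1 by rewrite expnS ltn_pmul2r.
have -> : p ^ (l + k).+2 - p ^ l.+1 + tau * p ^ l
   = (p - 1) * Q + (Q - p ^ l.+1 + tau * p ^ l) by rewrite EQ; nia.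
rewrite digit_prod_recr; last by rewrite EQ; nia.
rewrite -/Q divnMDl // modnMDl.
rewrite divn_small ?modn_small; [|lia..].
by rewrite IHk addn0 -subSn // subn1 expnS mulnCA.
Qed.

End DigitProducts.

(** * Weight of a polynomial *)

Section Weight.
Variable R : idomainType.
Implicit Types (f g h : {poly R}) (c : R).

Definition poly_weight f : nat := (\sum_(i < size f) (f`_i != 0)%R)%N.

Lemma poly_weight_widen n f : (size f <= n)%N ->
  poly_weight f = (\sum_(i < n) (f`_i != 0)%R)%N.
Proof.
move=> le_fn; rewrite /poly_weight.
rewrite (big_ord_widen n (fun i => nat_of_bool (f`_i != 0)) le_fn) big_mkcond.
by apply: eq_bigr => i _; case: ltnP => // le_fi; rewrite nth_default ?eqxx.
Qed.

Lemma poly_weight0 : poly_weight 0 = 0%N.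
Proof. by rewrite (@poly_weight_widen 0) ?size_poly0 // big_ord0. Qed.

Lemma poly_weight_gt0 f : f != 0 -> (0 < poly_weight f)%N.
Proof.
move=> f_neq0; have f_gt0 : (0 < size f)%N by rewrite size_poly_gt0.
rewrite /poly_weight -(prednK f_gt0) big_ord_recr /= -lead_coefE lead_coef_eq0.
by rewrite f_neq0 addn1.
Qed.

Lemma poly_weightD f g :
  (poly_weight (f + g) <= poly_weight f + poly_weight g)%N.
Proof.
have le_f := leq_maxl (size f) (size g).
have le_g := leq_maxr (size f) (size g).
rewrite (poly_weight_widen (size_polyD f g)).
rewrite (poly_weight_widen le_f) (poly_weight_widen le_g).
rewrite -big_split leq_sum // => i _; rewrite coefD.
have [->|_] := eqVneq f`_i 0; first by rewrite add0r.
by rewrite (leq_trans (leq_b1 _)) // leq_addr.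
Qed.

Lemma poly_weight_sum I (r : seq I) (F : I -> {poly R}) :
  (poly_weight (\sum_(i <- r) F i) <= \sum_(i <- r) poly_weight (F i))%N.
Proof.
elim/big_rec2: _ => [|i m f _ le_f]; first by rewrite poly_weight0.
by apply: leq_trans (poly_weightD _ _) _; rewrite leq_add2l.
Qed.

Lemma poly_weightZ c f : (poly_weight (c *: f) <= (c != 0%R) * poly_weight f)%N.
Proof.
have [->|c_neq0] := eqVneq c 0; first by rewrite scale0r poly_weight0.
rewrite mul1n (poly_weight_widen (size_scale_leq c f)) leq_sum // => i _.
by rewrite coefZ mulf_eq0 (negPf c_neq0).
Qed.

Lemma poly_weightXnM n f : poly_weight ('X^n * f) = poly_weight f.
Proof.
have le_f : (size ('X^n * f)%R <= n + size f)%N.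
  by apply: leq_trans (size_polyMleq _ _) _; rewrite size_polyXn.
rewrite (poly_weight_widen le_f) big_split_ord /= big1 ?add0n => [|i _].
  by apply: eq_bigr => i _; rewrite coefXnM ltnNge leq_addr addKn.
by rewrite coefXnM ltn_ord eqxx.
Qed.

Lemma poly_weightM f g :
  (poly_weight (f * g) <= poly_weight f * poly_weight g)%N.
Proof.
rewrite -{1}[f]coefK poly_def mulr_suml.
apply: leq_trans (poly_weight_sum _ _) _.
rewrite big_distrl leq_sum // => i _; rewrite -scalerAl.
by apply: leq_trans (poly_weightZ _ _) _; rewrite poly_weightXnM.
Qed.

Lemma poly_weight_binomial_exp n c d :
  (poly_weight (('X^n + c%:P) ^+ d) <= d.+1)%N.
Proof.
rewrite addrC exprDn; apply: leq_trans (poly_weight_sum _ _) _.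
rewrite -[leqRHS]card_ord -sum1_card leq_sum // => i _.
rewrite -polyC_exp mul_polyC -exprM scalerMnl.
apply: leq_trans (poly_weightZ _ _) _.
rewrite -['X^_]mulr1 poly_weightXnM -[leqRHS]mul1n leq_mul ?leq_b1 //.
by rewrite (@poly_weight_widen 1) ?size_poly1 // big_ord1 leq_b1.
Qed.

End Weight.

(** * Splitting a polynomial by residues of exponents *)

Section Sections.
Variable R : idomainType.
Implicit Types (f g h : {poly R}) (c : R).

(** The polynomial f_r in the decomposition of f as the sum over r < n of
X^r f_r(X^n), see [sum_poly_sections]; size f bounds its number of coefficients
when 0 < n. *)
Definition poly_section n r f : {poly R} := \poly_(i < size f) f`_(i * n + r).

Lemma coef_poly_section n r f i : (0 < n)%N ->
  (poly_section n r f)`_i = f`_(i * n + r).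
Proof.
move=> n_gt0; rewrite coef_poly; case: ltnP => // le_fi.
by rewrite nth_default // (leq_trans le_fi) //; nia.
Qed.

Lemma poly_sectionD n r f g : (0 < n)%N ->
  poly_section n r (f + g) = poly_section n r f + poly_section n r g.
Proof. by move=> n0; apply/polyP=> i; rewrite !(coefD, coef_poly_section). Qed.

(** Multiplying by a polynomial in X^n does not mix residues of exponents; hence
if g(X^n) divides a polynomial, then g divides each of its sections. *)
Lemma poly_section_mul_comp n r f g : (r < n)%N ->
  poly_section n r (f * (g \Po 'X^n)) = poly_section n r f * g.
Proof.
move=> lt_rn; have n_gt0 : (0 < n)%N by exact: leq_trans lt_rn.
elim/poly_ind: g => [|g c IHg].
  rewrite comp_poly0 !mulr0; apply/polyP => i.
  by rewrite coef_poly_section ?coef0.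
rewrite comp_polyD comp_polyM comp_polyX comp_polyC mulrDr mulrA.
rewrite poly_sectionD // mulrDr mulrA -IHg.
congr (_ + _); apply/polyP => i; last first.
  by rewrite coefMC !coef_poly_section ?coefMC.
rewrite coefMX coef_poly_section // coefMXn; case: i => [|i] /=.
  by rewrite mul0n lt_rn.
by rewrite coef_poly_section // mulSn -addnA ltnNge leq_addr addKn.
Qed.

Lemma poly_weight_sections n f : (0 < n)%N ->
  poly_weight f = (\sum_(r < n) poly_weight (poly_section n r f))%N.
Proof.
move=> n_gt0.
under eq_bigr => r _ do
  rewrite (poly_weight_widen (size_poly _ _)).
rewrite exchange_big /= (@poly_weight_widen _ (size f * n)); last by nia.
rewrite -(big_mkord predT (fun i => nat_of_bool (f`_i != 0))).
rewrite big_nat_mul big_mkord; apply: eq_bigr => i _.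
rewrite -{1}[(i * n)%N]add0n big_addn mulSn addnK big_mkord.
by apply: eq_bigr => r _; rewrite coef_poly_section // addnC.
Qed.

Lemma sum_poly_sections n f : (0 < n)%N ->
  f = \sum_(r < n) 'X^r * (poly_section n r f \Po 'X^n).
Proof.
move=> n_gt0; apply/polyP => i; rewrite coef_sum.
rewrite (bigD1 (Ordinal (ltn_pmod i n_gt0))) //= big1 => [|r neq_r]; last first.
  rewrite coefXnM coef_comp_poly_Xn //; case: ltnP => // le_ri.
  case: ifP => // /dvdnP[q def_q]; case/eqP: neq_r; apply: val_inj => /=.
  by rewrite -(subnK le_ri) def_q modnMDl modn_small.
rewrite addr0 coefXnM ltnNge leq_mod coef_comp_poly_Xn //.
have -> : (i - i %% n = i %/ n * n)%N by rewrite {1}(divn_eq i n) addnK.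
rewrite dvdn_mull // mulnK //.
by rewrite coef_poly_section // -divn_eq.
Qed.

End Sections.

(** * Weight and multiplicity of a root in characteristic p *)

Section RepeatedRoots.
Variables (F : fieldType) (p : nat).
Hypothesis pcharFp : p \in [pchar F].
Implicit Types (f g h : {poly F}) (a c : F).

Let p_prime : prime p := pcharf_prime pcharFp.

Lemma natr_inj_pchar i j : (i < p)%N -> (j < p)%N -> i%:R = j%:R :> F -> i = j.
Proof.
wlog le_ij : i j / (i <= j)%N => [IH lt_i lt_j eq_ij|lt_i lt_j eq_ij].
  by have [/IH|/ltnW/IH <-] := leqP i j; rewrite // => ->.
have : (p %| j - i)%N by rewrite (dvdn_pcharf pcharFp) natrB // eq_ij subrr.
by case: (posnP (j - i)) => [|d_gt0 /dvdn_leq]; lia.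
Qed.

Lemma exp_pcharD k f g : (f + g) ^+ (p ^ k) = f ^+ (p ^ k) + g ^+ (p ^ k).
Proof.
apply: exprDn_pchar; rewrite pnatX pnatE //.
by rewrite (rmorph_pchar (@polyC F)).
Qed.

Lemma exp_XsubC_pchar a n :
  ('X - a%:P) ^+ (p * n) = ('X - (a ^+ p)%:P) ^+ n \Po 'X^p.
Proof.
rewrite exprM -[in LHS](expn1 p) exp_pcharD expn1.
rewrite rmorphXn /= comp_polyB comp_polyX comp_polyC rmorphXn; congr (_ ^+ n).
congr (_ + _); have := exp_pcharD 1 (- a%:P) a%:P.
rewrite expn1 addNr expr0n gtn_eqF ?prime_gt0 // => /eqP.
by rewrite eq_sym addr_eq0 => /eqP.
Qed.

Lemma dvdp_exp_XsubC_deriv a e f :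
  ('X - a%:P) ^+ e.+1 %| f -> ('X - a%:P) ^+ e %| f^`().
Proof.
case/dvdpP=> g ->; rewrite derivM deriv_exp derivXsubC mul1r -mulr_natr.
by rewrite dvdp_add // dvdp_mull // ?dvdp_mulr // dvdp_exp2l.
Qed.

(** Induction on e: the operator X d/dX - j multiplies the coefficient at r by
r - j. It kills the leading term when j is the degree, changes no other term to
zero as exponents below p are distinct in F, and lowers the multiplicity of a by
at most one. *)
Lemma poly_weight_small_root a e f : a != 0 -> f != 0 -> (size f <= p)%N ->
  ('X - a%:P) ^+ e %| f -> (e < poly_weight f)%N.
Proof.
move=> a_neq0; elim: e f => [|e IHe] f f_neq0 le_fp dv_f.
  exact: poly_weight_gt0.
pose j := (size f).-1; pose g := 'X * f^`() - j%:R *: f.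
have sz_f : size f = j.+1 by rewrite prednK ?size_poly_gt0.
have coef_g i : g`_i = (i%:R - j%:R) * f`_i.
  rewrite coefB coefXM coefZ coef_deriv mulrBl; congr (_ - _).
  by case: i => [|i]; rewrite ?mul0r //= mulr_natl.
(* If g = 0 then f is a monomial, and a is not a root of a monomial. *)
have g_neq0 : g != 0.
  apply: contraTneq dv_f => g0.
  have -> : f = f`_j *: 'X^j.
    apply/polyP => i; rewrite coefZ coefXn.
    have [->|neq_ij] := eqVneq i j; rewrite ?mulr1 ?mulr0 //.
    have [le_fi|lt_if] := leqP (size f) i; first by rewrite nth_default.
    have /eqP := coef_g i; rewrite g0 coef0 eq_sym mulf_eq0 subr_eq0.
    case/orP => /eqP // /natr_inj_pchar eq_ij.
    by case/eqP: neq_ij; apply: eq_ij; lia.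
  apply/negP => /(dvdp_trans (dvdp_exp2l _ (isT : 1 <= e.+1)%N)).
  rewrite expr1 dvdp_XsubCl rootE hornerZ hornerXn mulf_eq0 expf_eq0.
  by rewrite (negPf a_neq0) andbF orbF -lead_coefE lead_coef_eq0 (negPf f_neq0).
have dv_g : ('X - a%:P) ^+ e %| g.
  rewrite dvdp_sub ?[_ %| 'X * _]dvdp_mull ?dvdp_exp_XsubC_deriv //.
  by rewrite -mul_polyC dvdp_mull // (dvdp_trans _ dv_f) // dvdp_exp2l.
have le_g : (size g <= size f)%N.
  apply/leq_sizeP => i le_fi; rewrite coef_g (nth_default _ le_fi) mulr0 //.
apply: leq_ltn_trans (IHe g g_neq0 (leq_trans le_g le_fp) dv_g) _.
rewrite (poly_weight_widen le_g) /poly_weight sz_f !big_ord_recr /=.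
rewrite coef_g subrr mul0r eqxx addn0 -lead_coefE lead_coef_eq0 f_neq0.
rewrite addn1 ltnS; apply: leq_sum => i _; rewrite coef_g mulf_eq0.
by case: (f`_i == 0); rewrite ?orbT ?leq_b1.
Qed.

(** The multiplicity of a has to be exactly e: the two terms of X^p - a^p are
fewer than the p terms that its divisor (X - a)^(p-1) would predict. *)
Lemma poly_weight_root_mult s a e h : a != 0 -> h.[a] != 0 ->
  (digit_prod p s e <= poly_weight (('X - a%:P) ^+ e * h))%N.
Proof.
have p_gt0 := prime_gt0 p_prime.
elim: s a e h => [|s IHs] a e h a_neq0 ha_neq0.
  rewrite /digit_prod big_ord0 poly_weight_gt0 // mulf_neq0 //.
    by rewrite expf_neq0 // polyXsubC_eq0.
  by apply: contraNneq ha_neq0 => ->; rewrite horner0.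
pose t := (e %/ p)%N; pose e0 := (e %% p)%N; pose b := a ^+ p.
have b_neq0 : b != 0 by rewrite expf_neq0.
pose g := ('X - a%:P) ^+ e0 * h; pose gs r := poly_section p r g.
pose G := \poly_(r < p) (gs r).[b].
have e_def : e = (e0 + p * t)%N by rewrite mulnC addnC -divn_eq.
have sec r : (r < p)%N ->
    poly_section p r (('X - a%:P) ^+ e * h) = gs r * ('X - b%:P) ^+ t.
  move=> lt_rp; rewrite e_def exprD -mulrA [_ ^+ (p * t) * h]mulrC mulrA.
  by rewrite exp_XsubC_pchar poly_section_mul_comp.
have XbE : ('X - b%:P) \Po 'X^p = ('X - a%:P) ^+ p.
  by have := exp_XsubC_pchar a 1; rewrite muln1 expr1.
(* X^p and a^p agree modulo (X - a)^p, so g and G have the same divisibility by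
   powers of X - a up to p. *)
have dv_gG : ('X - a%:P) ^+ p %| g - G.
  rewrite {1}(sum_poly_sections g p_gt0) /G poly_def -sumrB.
  elim/big_ind: _ => [|f1 f2|r _]; [exact: dvdp0|exact: dvdp_add|].
  rewrite -mul_polyC mulrC -mulrBl dvdp_mulr //.
  rewrite -(comp_polyC (gs r).[b] 'X^p) -comp_polyB -XbE dvdp_comp_poly //.
  by rewrite dvdp_XsubCl rootE hornerD hornerN hornerC subrr.
have lt_e0 : (e0 < p)%N by rewrite ltn_mod.
have dv_G : ('X - a%:P) ^+ e0 %| G.
  rewrite -(dvdp_subr _ (dvdp_mulr h (dvdpp (('X - a%:P) ^+ e0)))).
  by rewrite (dvdp_trans _ dv_gG) // dvdp_exp2l // ltnW.
have G_neq0 : G != 0.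
  apply: contraNneq ha_neq0 => G0.
  have : ('X - a%:P) ^+ e0.+1 %| g.
    by move: dv_gG; rewrite G0 subr0; apply: dvdp_trans; rewrite dvdp_exp2l.
  rewrite exprSr dvdp_mul2l ?dvdp_XsubCl //.
  by rewrite expf_neq0 // polyXsubC_eq0.
have lt_wG := poly_weight_small_root a_neq0 G_neq0 (size_poly _ _) dv_G.
(* Only the sections indexed by nonzero coefficients of G are counted. *)
rewrite digit_prod_recl (poly_weight_sections _ p_gt0).
apply: leq_trans (_ : poly_weight G * digit_prod p s t <= _)%N.
  by rewrite leq_mul2r lt_wG orbT.
rewrite (poly_weight_widen (size_poly _ _)) big_distrl leq_sum // => r _.
rewrite coef_poly ltn_ord sec //; have [//|gr_neq0] := eqVneq.
by rewrite /= mul1n mulrC IHs.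
Qed.

End RepeatedRoots.

(** * Weights of multiples of a power of a binomial *)

Section BinomialWeights.
Variables (F : fieldType) (p : nat).
Hypothesis pcharFp : p \in [pchar F].
Variables (gamma : F) (eta : nat).
Local Notation f := ('X^eta + gamma%:P).

(** The factor for the digit d at p^j is (X^(eta p^j) + gamma^(p^j))^d, with at
most d + 1 terms. *)
Lemma poly_weight_exp_binomial s e : (e < p ^ s)%N ->
  (poly_weight (f ^+ e) <= digit_prod p s e)%N.
Proof.
have p_gt0 := prime_gt0 (pcharf_prime pcharFp).
elim: s e => [|s IHs] e lt_e.
  have -> : e = 0%N by case: e lt_e.
  rewrite /digit_prod big_ord0 expr0.
  by rewrite (@poly_weight_widen _ 1) ?size_poly1 // big_ord1 leq_b1.
have ps_gt0 : (0 < p ^ s)%N by rewrite expn_gt0 p_gt0.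
rewrite digit_prod_recr // {1}(divn_eq e (p ^ s)) exprD.
apply: leq_trans (poly_weightM _ _) _; rewrite leq_mul ?IHs ?ltn_pmod //.
rewrite mulnC exprM (exp_pcharD pcharFp) -exprM -polyC_exp.
exact: poly_weight_binomial_exp.
Qed.

(** A nonzero section of c modulo eta is a multiple of (X + gamma)^i of degree
less than p^s, which bounds the multiplicity e of its root - gamma. *)
Lemma digit_prod_le_multiple s i (c : {poly F}) :
    gamma != 0 -> (0 < eta)%N -> c != 0 -> (size c <= eta * p ^ s)%N ->
    f ^+ i %| c ->
  exists e, (i <= e < p ^ s)%N /\ (digit_prod p s e <= poly_weight c)%N.
Proof.
move=> g_neq0 eta_gt0 c_neq0 le_c /dvdpP[h def_c].
have [r cr_neq0 | c0] := pickP (fun r : 'I_eta => poly_section eta r c != 0);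
  last first.
  case/eqP: c_neq0; rewrite (sum_poly_sections c eta_gt0) big1 // => r _.
  by have /negPn/eqP -> := negbT (c0 r); rewrite comp_poly0 mulr0.
set cr := poly_section _ _ _ in cr_neq0.
have fE : f ^+ i = ('X - (- gamma)%:P) ^+ i \Po 'X^eta.
  by rewrite rmorphXn /= comp_polyB comp_polyX comp_polyC polyCN opprK.
have dv_cr : ('X - (- gamma)%:P) ^+ i %| cr.
  by rewrite /cr def_c fE poly_section_mul_comp // dvdp_mulIr.
have [e [u]] := multiplicity_XsubC cr (- gamma).
rewrite cr_neq0 /= => u_root def_cr.
have X_neq0 : ('X - (- gamma)%:P) != 0 by rewrite polyXsubC_eq0.
have ps_gt0 : (0 < p ^ s)%N.
  by rewrite expn_gt0 prime_gt0 ?(pcharf_prime pcharFp).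
have sz_cr : (size cr <= p ^ s)%N.
  apply/leq_sizeP => j le_j; rewrite coef_poly_section // nth_default //.
  by apply: leq_trans le_c _; nia.
have u_neq0 : u != 0 by apply: contraNneq u_root => ->; rewrite root0.
exists e; split; last first.
  rewrite (poly_weight_sections c eta_gt0) (bigD1 r) //=.
  apply: leq_trans (leq_addr _ _); rewrite -/cr def_cr mulrC.
  by apply: poly_weight_root_mult; rewrite ?oppr_eq0.
apply/andP; split.
  rewrite leqNgt; apply: contra u_root => lt_ei.
  have := dvdp_trans (dvdp_exp2l ('X - (- gamma)%:P) lt_ei) dv_cr.
  by rewrite def_cr exprS dvdp_mul2r ?expf_neq0 // dvdp_XsubCl.
have := sz_cr; rewrite def_cr size_Mmonic ?monic_exp ?monicXsubC //.
rewrite size_exp_XsubC.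
have u_gt0 : (0 < size u)%N by rewrite size_poly_gt0.
by rewrite addnS; apply: leq_trans; rewrite -add1n leq_add2r.
Qed.

End BinomialWeights.

(** * Constacyclic codes as ideals *)

Section ConstacyclicCodes.
Variables (F : finFieldType) (N : nat) (lambda : F).
Hypothesis N_gt0 : (0 < N)%N.
Implicit Types (c : 'rV[F]_N) (C D : {set 'rV[F]_N}) (f g : {poly F}).
Local Notation M := ('X^N - lambda%:P).

Lemma in_qpoly_eq f g : (in_qpoly M f == in_qpoly M g) = (M %| f - g).
Proof.
have monM : M \is monic by rewrite monicXnsubC.
have mkM : mk_monic M = M by rewrite /mk_monic size_XnsubC // ltnS N_gt0 monM.
rewrite -val_eqE /= mkM -!(Pdiv.IdomainMonic.modpE monM).
by rewrite -subr_eq0 -modpN -modpD.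
Qed.

(** As g divides the modulus, divisibility by g depends only on the class. *)
Lemma mem_ideal_code g c : g %| M ->
  (c \in ideal_code N lambda g) = (g %| rVpoly c).
Proof.
move=> g_dv; rewrite inE.
apply/existsP/idP => [[q]|/dvdpP[q def_c]]; last first.
  by exists (in_qpoly M q); rewrite /codeword_poly def_c in_qpolyM.
have qE : q = in_qpoly M (q : {poly F}).
  by apply: val_inj; rewrite /= Pdiv.Ring.rmodp_small // size_mk_monic.
rewrite qE -in_qpolyM in_qpoly_eq => /(dvdp_trans g_dv).
by rewrite dvdp_subl // dvdp_mulIr.
Qed.

Lemma size_rVpoly c : (size (rVpoly c) <= N)%N.
Proof. exact: size_poly. Qed.

Lemma hamming_weight_rVpoly c : hamming_weight c = poly_weight (rVpoly c).
Proof.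
rewrite (poly_weight_widen (size_rVpoly c)) /hamming_weight -sum1_card.
rewrite big_mkcond; apply: eq_bigr => j _; rewrite inE coef_rVpoly_ord.
by case: (c 0 j != 0).
Qed.

Lemma rVpoly_neq0 c : (rVpoly c != 0) = (c != 0).
Proof. by rewrite -(inj_eq (can_inj rVpolyK)) linear0. Qed.

(** The shift subtracts c_(N-1) times the modulus from X c. *)
Lemma rVpoly_constashift c :
  rVpoly (constashift lambda c) = ('X * rVpoly c) %% M.
Proof.
have monM : M \is monic by rewrite monicXnsubC.
pose a := (rVpoly c)`_N.-1.
have -> : 'X * rVpoly c = a%:P * M + rVpoly (constashift lambda c).
  apply/polyP => i; rewrite coefXM coefD coefCM coefB coefXn coefC.
  have [lt_iN|le_Ni] := ltnP i N; last first.
    rewrite [(rVpoly (constashift _ _))`_i]nth_default; last first.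
      exact: leq_trans (size_rVpoly _) _.
    rewrite [i == 0%N]gtn_eqF ?(leq_trans N_gt0) // subr0 addr0.
    have [->|neq_iN] := eqVneq; first by rewrite mulr1.
    by rewrite mulr0 nth_default // (leq_trans (size_rVpoly _)) //; lia.
  rewrite (coef_rVpoly_ord (constashift lambda c) (Ordinal lt_iN)) mxE /=.
  rewrite [i == N]ltn_eqF // mulr0n sub0r -(coef_rVpoly_ord c) /=.
  case: i lt_iN => [|i] lt_iN /=.
    by rewrite add0n modn_small ?ltn_predL // mulrN mulrC addNr.
  rewrite oppr0 mulr0 add0r; congr (_`_ _).
  by rewrite modnDr modn_small // ltnW.
rewrite modpD modp_mull add0r modp_small // size_XnsubC // ltnS.
exact: size_rVpoly.
Qed.

Lemma min_distance_eq C c0 d : c0 \in C -> c0 != 0 ->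
    (hamming_weight c0 <= d)%N ->
    (forall c, c \in C -> c != 0 -> (d <= hamming_weight c)%N) ->
  min_distance C = d.
Proof.
move=> Cc0 c0_neq0 le_d ge_d.
have le_dN : (d <= N)%N.
  apply: leq_trans (ge_d _ Cc0 c0_neq0) _.
  by rewrite -[leqRHS]card_ord max_card.
apply/eqP; rewrite eqn_leq /min_distance -minEnat; apply/andP; split.
  rewrite -leEnat; apply: (Order.TotalTheory.bigmin_inf c0).
    by rewrite Cc0.
  by rewrite leEnat.
rewrite -leEnat; apply: Order.POrderTheory.le_bigmin => // c /andP[Cc c_neq0].
by rewrite leEnat ge_d.
Qed.

Lemma constacyclic_ideal_code g : lambda != 0 -> g %| M ->
  constacyclic lambda (ideal_code N lambda g).
Proof.
move=> lambda_neq0 g_dv; split=> // [|c]; last first.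
  rewrite !mem_ideal_code // rVpoly_constashift => dv_c.
  by rewrite -(dvdp_mod _ g_dv) dvdp_mull.
split=> [|a c1 c2]; first by rewrite mem_ideal_code // linear0 dvdp0.
rewrite !mem_ideal_code // linearP => dv1 dv2.
by rewrite /= dvdp_add // -mul_polyC dvdp_mull.
Qed.

(** Closure under the shift is closure under multiplication by X. *)
Lemma constacyclic_mulr D c v : constacyclic lambda D -> c \in D ->
  poly_rV ((v * rVpoly c) %% M) \in D.
Proof.
case=> lambda_neq0 [D0 DP] Dshift Dc.
elim/poly_ind: v => [|v a IHv]; first by rewrite mul0r mod0p linear0.
have -> : (v * 'X + a%:P) * rVpoly c
          = a *: rVpoly c + 'X * (v * rVpoly c) by rewrite -mul_polyC; ring.
have c_small : (size (rVpoly c) < size M)%N.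
  by rewrite size_XnsubC // ltnS size_rVpoly.
rewrite modpD modpZl (modp_small c_small) linearP /= rVpolyK DP //.
rewrite -modp_mul -[(v * _) %% M](@poly_rV_K _ N); last first.
  rewrite -ltnS -(size_XnsubC lambda N_gt0) ltn_modp.
  by rewrite -size_poly_gt0 size_XnsubC.
by rewrite -rVpoly_constashift rVpolyK Dshift.
Qed.

(** F[X]/<f^P> is a chain ring: modulo f^P, everything prime to f is
invertible. *)
Lemma constacyclic_irreducible_exp f P D : irreducible_poly f -> f ^+ P = M ->
    constacyclic lambda D ->
  exists2 i, (i <= P)%N & D = ideal_code N lambda (f ^+ i).
Proof.
move=> irr_f fP cycD.
have dv_f i : (i <= P)%N -> f ^+ i %| M by rewrite -fP; exact: dvdp_exp2l.
pose Q i := (i <= P)%N && [forall c in D, f ^+ i %| rVpoly c].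
have Q0 : exists i, Q i.
  by exists 0%N; apply/forall_inP => c _; rewrite expr0 dvd1p.
have Qle i : Q i -> (i <= P)%N by case/andP.
case: (ex_maxnP Q0 Qle) => i /andP[le_iP /forall_inP dvD] max_i.
exists i => //; apply/setP => c; rewrite mem_ideal_code ?dv_f //.
apply/idP/idP => [|/dvdpP[w def_c]]; first exact: dvD.
(* For i = P the degree bound leaves only the zero word. *)
have [lt_iP|le_Pi] := ltnP i P; last first.
  have c0 : rVpoly c = 0.
    apply/eqP; rewrite -[_ == 0]negbK; apply: contraTN (leqnn N) => c_neq0.
    have : f ^+ P %| rVpoly c by rewrite def_c dvdp_mull // dvdp_exp2l.
    rewrite fP => /(dvdp_leq c_neq0); rewrite size_XnsubC //.
    by move/leq_trans/(_ (size_rVpoly c)); rewrite ltnn.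
  by rewrite -(rVpolyK c) c0 linear0; case: cycD => _ [].
have /forall_inPn[c0 Dc0 ndv] : ~~ [forall c in D, f ^+ i.+1 %| rVpoly c].
  by apply/negP => dv; have := max_i i.+1; rewrite /Q lt_iP dv ltnn => /(_ isT).
have /dvdpP[u def_c0] := dvD _ Dc0.
have f_neq0 := irredp_neq0 irr_f.
have co_fu : coprimep u (f ^+ (P - i)).
  rewrite coprimep_expr // coprimep_sym irreducible_poly_coprime //.
  by apply: contra ndv => ?; rewrite def_c0 exprS dvdp_mul2r ?expf_neq0.
have /Bezout_eq1_coprimepP[[x y] /= xy1] := co_fu.
(* x inverts u modulo f^(P - i), so f^i is congruent to x times c0 modulo M. *)
have def_rc : rVpoly c = (w * x) * rVpoly c0 + (w * y) * M.
  have -> : M = f ^+ (P - i) * f ^+ i by rewrite -exprD subnK.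
  by rewrite def_c def_c0 -[LHS]mulr1 -xy1; ring.
have c_small : (size (rVpoly c) < size M)%N.
  by rewrite size_XnsubC // ltnS size_rVpoly.
rewrite -(rVpolyK c) -(modp_small c_small) def_rc modpD modp_mull addr0.
exact: constacyclic_mulr.
Qed.

End ConstacyclicCodes.

(** * Codes generated by powers of a binomial *)

Section BinomialCodes.
Variables (p : nat) (F : finFieldType) (gamma : F) (eta s : nat).
Hypotheses (pcharFp : p \in [pchar F]) (gamma_neq0 : gamma != 0).
Hypothesis eta_gt0 : (0 < eta)%N.
Local Notation f := ('X^eta + gamma%:P).
Local Notation N := (eta * p ^ s)%N.
Local Notation lambda := (- gamma ^+ (p ^ s)).
Local Notation code i := (@ideal_code F N lambda (f ^+ i)).

Lemma binomial_exp_pchar : f ^+ (p ^ s) = 'X^N - lambda%:P.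
Proof. by rewrite (exp_pcharD pcharFp) -exprM -polyC_exp polyCN opprK. Qed.

Let p_gt0 : (0 < p)%N := prime_gt0 (pcharf_prime pcharFp).

Let N_gt0 : (0 < N)%N.
Proof. by rewrite muln_gt0 eta_gt0 expn_gt0 p_gt0. Qed.

Lemma mem_binomial_code i c : (i <= p ^ s)%N ->
  (c \in code i) = (f ^+ i %| rVpoly c).
Proof.
by move=> le_i; rewrite mem_ideal_code // -binomial_exp_pchar dvdp_exp2l.
Qed.

Lemma binomial_code_eq0 : code (p ^ s)%N = [set 0].
Proof.
apply/setP => c; rewrite mem_binomial_code // inE binomial_exp_pchar.
apply/idP/eqP => [dv_c|->]; last by rewrite linear0 dvdp0.
apply/eqP; rewrite -[_ == 0]negbK -rVpoly_neq0; apply: contraTN (leqnn N).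
move=> c_neq0; have := dvdp_leq c_neq0 dv_c; rewrite size_XnsubC //.
by move/leq_trans/(_ (size_rVpoly c)); rewrite ltnn.
Qed.

Lemma size_binomial_exp e : size (f ^+ e) = (eta * e).+1.
Proof.
have f_neq0 : f != 0 by rewrite -size_poly_gt0 size_XnaddC.
have := size_exp f e; rewrite size_XnaddC //= => <-.
by rewrite prednK // size_poly_gt0 expf_neq0.
Qed.

(** The word f^e0 attains the lower bound of [digit_prod_le_multiple]. *)
Lemma min_distance_binomial_code i e0 : (i <= e0 < p ^ s)%N ->
    (forall e, i <= e < p ^ s -> digit_prod p s e0 <= digit_prod p s e)%N ->
  min_distance (code i) = digit_prod p s e0.
Proof.
case/andP=> le_i lt_e0 min_e0.
have le_ips : (i <= p ^ s)%N := ltnW (leq_ltn_trans le_i lt_e0).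
pose c0 : 'rV[F]_N := poly_rV (f ^+ e0).
have c0E : rVpoly c0 = f ^+ e0.
  by rewrite poly_rV_K // size_binomial_exp ltn_pmul2l.
have c0_neq0 : c0 != 0.
  by rewrite -rVpoly_neq0 c0E -size_poly_gt0 size_binomial_exp.
apply: (min_distance_eq (c0 := c0)) => // [||c].
- by rewrite mem_binomial_code // c0E dvdp_exp2l.
- by rewrite hamming_weight_rVpoly c0E poly_weight_exp_binomial.
rewrite mem_binomial_code // -rVpoly_neq0 hamming_weight_rVpoly => dv_c c_neq0.
have [e [e_range le_e]] := digit_prod_le_multiple pcharFp gamma_neq0 eta_gt0
  c_neq0 (size_rVpoly c) dv_c.
exact: leq_trans (min_e0 e e_range) le_e.
Qed.

Lemma min_distance_band i tau k : (0 < tau < p)%N -> (k < s)%N ->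
    (p ^ s - p ^ (s - k) + (tau - 1) * p ^ (s - k - 1) + 1 <= i
       <= p ^ s - p ^ (s - k) + tau * p ^ (s - k - 1))%N ->
  min_distance (code i) = ((tau + 1) * p ^ k)%N.
Proof.
move=> tau_range lt_ks; have /andP[tau_gt0 lt_tau] := tau_range.
have [l def_s] : exists l, s = (l + k).+1 by exists (s - k - 1)%N; lia.
have -> : (s - k = l.+1)%N by lia.
rewrite subSS subn0 => /andP[lo_i hi_i].
have le_l : (p ^ l.+1 <= p ^ s)%N by rewrite leq_pexp2l // def_s; lia.
have lt_tl : (tau * p ^ l < p ^ l.+1)%N.
  by rewrite expnS ltn_pmul2r // expn_gt0 p_gt0.
have end_val := digit_prod_band_end l k lt_tau; rewrite -def_s in end_val.
rewrite -end_val; apply: min_distance_binomial_code => [|e /andP[le_ie lt_e]].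
  by rewrite hi_i; lia.
rewrite end_val def_s; apply: digit_prod_band; rewrite -?def_s //; lia.
Qed.

End BinomialCodes.

Unset Implicit Arguments.
Set Strict Implicit.
Set Printing Implicit Defensive.

Theorem theorem7p6 (p m : nat) (F : finFieldType) (gamma : F) (eta s : nat)
    (p_prime : prime p) (cardF : #|F| = (p ^ m)%N) (gamma_neq0 : gamma != 0)
    (eta_gt0 : (0 < eta)%N) (s_gt0 : (0 < s)%N)
    (irr : irreducible_poly ('X^eta + gamma%:P)) :
  let N := (eta * p ^ s)%N in
  let lambda := - gamma ^+ (p ^ s) in
  let C := fun i : nat =>
    @ideal_code F N lambda (('X^eta + gamma%:P) ^+ i) in
  let d := fun i : nat => min_distance (C i) in
  [/\ forall D : {set 'rV[F]_N},
        constacyclic lambda D <-> exists2 i : nat, (i <= p ^ s)%N & D = C i,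
      C 0%N = [set: 'rV[F]_N] /\ d 0%N = 1%N,
      C (p ^ s)%N = [set 0],
      p = 2%N ->
        (forall i : nat, (1 <= i <= 2 ^ (s - 1))%N -> d i = 2%N) /\
        (forall i k : nat, (1 <= k <= s - 1)%N ->
           (2 ^ s - 2 ^ (s - k) + 1 <= i
              <= 2 ^ s - 2 ^ (s - k) + 2 ^ (s - k - 1))%N ->
           d i = (2 ^ (k + 1))%N)
    & odd p ->
        [/\ forall i : nat, (1 <= i <= p ^ (s - 1))%N -> d i = 2%N,
            forall i beta : nat, (1 <= beta <= p - 2)%N ->
              (beta * p ^ (s - 1) + 1 <= i <= (beta + 1) * p ^ (s - 1))%N ->
              d i = (beta + 2)%N
          & forall i tau k : nat, (1 <= tau <= p - 1)%N ->
              (1 <= k <= s - 1)%N ->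
              (p ^ s - p ^ (s - k) + (tau - 1) * p ^ (s - k - 1) + 1 <= i
                 <= p ^ s - p ^ (s - k) + tau * p ^ (s - k - 1))%N ->
              d i = ((tau + 1) * p ^ k)%N]].
Proof.
have pcharFp := card_finPcharP cardF p_prime.
have p_gt1 := prime_gt1 p_prime.
move=> N lambda C d.
have band i tau k (tau_range : (0 < tau < p)%N) (lt_ks : (k < s)%N) :=
  @min_distance_band p F gamma eta s pcharFp gamma_neq0 eta_gt0 i tau k
    tau_range lt_ks.
have band0 i tau : (0 < tau < p)%N ->
    ((tau - 1) * p ^ (s - 1) + 1 <= i <= tau * p ^ (s - 1))%N ->
    d i = (tau + 1)%N.
  move=> tau_range i_range; rewrite /d /C (band i tau 0%N) ?muln1 //.
  by rewrite subn0 subnn !add0n.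
have N_gt0 : (0 < N)%N by rewrite muln_gt0 eta_gt0 expn_gt0 ltnW.
have lambda_neq0 : lambda != 0 by rewrite oppr_eq0 expf_neq0.
have expE := binomial_exp_pchar gamma eta s pcharFp.
split.
- move=> D; split=> [cycD|[i le_i ->]].
    exact: (constacyclic_irreducible_exp N_gt0 irr expE cycD).
  apply: (constacyclic_ideal_code N_gt0 lambda_neq0).
  by rewrite -expE dvdp_exp2l.
- split.
    apply/setP => c; rewrite (mem_binomial_code gamma pcharFp) //.
    by rewrite expr0 dvd1p inE.
  have digit0 : digit_prod p s 0 = 1%N.
    by rewrite /digit_prod big1 // => j _; rewrite div0n mod0n.
  rewrite -[RHS]digit0; apply: min_distance_binomial_code => // [|e _].
    by rewrite leqnn expn_gt0 ltnW.
  by rewrite digit0 digit_prod_gt0.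
- exact: binomial_code_eq0.
- move=> p2; subst p; split=> [i i_range|i k k_range i_range].
    by rewrite (band0 i 1%N) // mul1n.
  rewrite /d /C (band i 1%N k) ?addn1 ?expnS //; first lia.
  by rewrite subnn mul0n addn0 mul1n -addn1.
- move=> _; split=> [i i_range|i b b_range i_range
                     |i tau k tau_range k_range i_range].
  + by rewrite (band0 i 1%N) ?p_gt1 // subnn mul0n add0n mul1n.
  + by rewrite (band0 i (b + 1)%N) ?addnK // -?addnA //; lia.
  + by apply: band => //; lia.
Qed.
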